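(* Let $I$ be a monomial ideal in the polynomial ring $S=\kappa[x_1,\ldots,x_n]$ over a field $\kappa$, and let $\mathbf{n}\in\mathrm{MinGens}(I)$ and $\mathbf{m}\in C_I(\mathbf{n})$ be such that $\mathbf{m}\mid\mathbf{n}$. Let $\Delta$ be a simplicial complex whose vertices are labeled with the minimal generators of $I$, and let $\Gamma$ be the same simplicial complex as $\Delta$, except that the vertex labeled $\mathbf{n}$ in $\Delta$ is labeled $\mathbf{m}$ in $\Gamma$. Then: 1. For every monomial $\mathbf{u}\in \mathbb{L}_I\setminus\{\mathbf{n}\}=\mathbb{L}_{I+(\mathbf{m})}\setminus\{\mathbf{m}\}$, $\Delta_{\le\mathbf{u}}=\Gamma_{\le\mathbf{u}}$ and $\Delta_{<\mathbf{u}}=\Gamma_{<\mathbf{u}}$ (as subcomplexes of the common underlying simplicial complex). 2. $\Delta$ supports a free resolution of $I$ if and only if $\Gamma$ supports a free resolution of $I+(\mathbf{m})$; and $\Delta$ supports a minimal free resolution of $I$ if and only if $\Gamma$ supports a minimal free resolution of $I+(\mathbf{m})$.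
   Context: $\mathrm{MinGens}(I)$ is the unique minimal monomial generating set of $I$; $\gcd(I)$ is the gcd of its elements. $\mathbb{L}_I$ is the lcm lattice of $I$: the set of lcms of subsets of $\mathrm{MinGens}(I)$ (with $\mathrm{lcm}(\emptyset)=1$), ordered by divisibility. For monomials $\mathbf{u}=x_1^{g_1}\cdots x_n^{g_n}$ and $\mathbf{n}=x_1^{c_1}\cdots x_n^{c_n}$ with $\mathbf{u}\mid\mathbf{n}$, $C_{\mathbf{u}}(\mathbf{n})$ is the set of monomials $x_1^{d_1}\cdots x_n^{d_n}\ne1$ such that $d_i\ge c_i$ for every $i$ with $c_i\neq g_i$, and $d_i<c_i$ for at least one $i$ with $c_i=g_i$. For a monomial $\mathbf{n}\in I$, $C_I(\mathbf{n})=C_{\gcd(I)}(\mathbf{n})$. In a simplicial complex $\Delta$ with vertices labeled by monomials, each face $\sigma$ has label $\mathrm{lcm}(\sigma)$, the lcm of the labels of its vertices ($\mathrm{lcm}(\emptyset)=1$). $\Delta_{\le\mathbf{u}}=\{\sigma\in\Delta:\mathrm{lcm}(\sigma)\mid\mathbf{u}\}$ and $\Delta_{<\mathbf{u}}=\{\sigma\in\Delta:\mathrm{lcm}(\sigma)\mid\mathbf{u},\ \mathrm{lcm}(\sigma)\neq\mathbf{u}\}$. If the labels of $\Delta$ generate the ideal $J$, let $\mathbb{F}_\Delta$ be the complex of free $S$-modules with one basis element $e_\sigma$ in homological degree $|\sigma|$ for each face $\sigma$ (including $\emptyset$) and differential $e_\sigma\mapsto\sum_{v\in\sigma}\pm\frac{\mathrm{lcm}(\sigma)}{\mathrm{lcm}(\sigma\setminus\{v\})}e_{\sigma\setminus\{v\}}$,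 signs as in the simplicial chain complex. $\Delta$ supports a (minimal) free resolution of $J$ if $\mathbb{F}_\Delta$ is a (minimal) free resolution of $S/J$. *)

(* Defs.v *)
From HB Require Import structures.
From mathcomp Require Import all_boot all_order all_algebra.
From mathcomp.multinomials Require Import mpoly.

Set Implicit Arguments.
Unset Strict Implicit.
Unset Printing Implicit Defensive.

Import GRing.Theory.
Local Open Scope ring_scope.

(* A monomial x_1^{a_1}...x_k^{a_k} is identified with its exponent vector
   a : 'X_{1..k}; then 0%MM is the monomial 1, (a <= b)%MM is divisibility and
   'X_[a] is the corresponding polynomial.  Ideals of {mpoly K[k]} are
   Prop-valued predicates, with no properness or decidability requirement. *)

Section MonomialIdeals.
Variables (K : fieldType) (k : nat).
Local Notation S := {mpoly K[k]}.
Implicit Types (I J A : S -> Prop) (G : 'X_{1..k} -> Prop).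

Definition ideal_gen A : S -> Prop := fun p =>
  exists2 s : seq (S * S),
    (forall x, x \in s -> A x.2) & p = \sum_(x <- s) x.1 * x.2.

Definition ideal_add I J : S -> Prop := fun p =>
  exists a b, [/\ I a, J b & p = a + b].

Definition monomial_gens G : S -> Prop := fun p =>
  exists2 u, G u & p = 'X_[u].

Definition generates G I : Prop :=
  forall p, I p <-> ideal_gen (monomial_gens G) p.

Definition monomial_ideal I : Prop := exists G, generates G I.

Definition minimal_generating_set I G : Prop :=
  generates G I /\
  (forall G', (forall u, G' u -> G u) -> generates G' I ->
    forall u, G u -> G' u).

(* Membership in the (unique) minimal monomial generating set. *)
Definition MinGens I : 'X_{1..k} -> Prop := fun u =>
  exists2 G, minimal_generating_set I G & G u.

Definition add_monomial I (m : 'X_{1..k}) : S -> Prop :=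
  ideal_add I (ideal_gen (fun p => p = 'X_[m])).

Definition poly_dvd (d p : S) : Prop := exists q, p = q * d.

(* The gcd of the elements of I is a polynomial up to units; for a nonzero
   monomial ideal this selects its monomial representative. *)
Definition is_gcd I (u : 'X_{1..k}) : Prop :=
  (forall p, I p -> poly_dvd 'X_[u] p) /\
  (forall d, (forall p, I p -> poly_dvd d p) -> poly_dvd d 'X_[u]).

Definition Cset_mon (u n : 'X_{1..k}) : 'X_{1..k} -> Prop := fun d =>
  [/\ d <> 0%MM,
      forall i : 'I_k, n i <> u i -> (n i <= d i)%N
    & exists2 i : 'I_k, n i = u i & (d i < n i)%N].

Definition Cset I (n : 'X_{1..k}) : 'X_{1..k} -> Prop := fun d =>
  exists2 u, is_gcd I u & Cset_mon u n d.

(* MinGens I is finite, so its subsets are enumerated by finite sequences. *)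
Definition lcm_lattice I : 'X_{1..k} -> Prop := fun u =>
  exists2 s : seq 'X_{1..k},
    (forall a, a \in s -> MinGens I a) & u = \big[@mlcm k/0%MM]_(a <- s) a.

(* The ideal (x_1, ..., x_k). *)
Definition irrelevant_ideal : S -> Prop :=
  ideal_gen (fun p => exists i : 'I_k, p = 'X_i).

End MonomialIdeals.

Definition simplicial_complex (V : finType) (D : {set {set V}}) : Prop :=
  [/\ set0 \in D,
      forall v, [set v] \in D
    & forall s t : {set V}, s \in D -> t \subset s -> t \in D].

Section LabeledComplex.
Variables (K : fieldType) (k : nat) (V : finType).
Variables (lab : V -> 'X_{1..k}) (D : {set {set V}}).
Local Notation S := {mpoly K[k]}.

Definition lcm_face (s : {set V}) : 'X_{1..k} :=
  \big[@mlcm k/0%MM]_(v in s) lab v.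

Definition subcx_le (u : 'X_{1..k}) : {set {set V}} :=
  [set s in D | (lcm_face s <= u)%MM].

Definition subcx_lt (u : 'X_{1..k}) : {set {set V}} :=
  [set s in D | (lcm_face s <= u)%MM && (lcm_face s != u)].

Definition face (i : nat) : finType :=
  {s : {set V} | (s \in D) && (#|s| == i)}.

(* The free module of F_D in homological degree i: elements are the tuples of
   coordinates in the basis (e_s), s a face with i vertices. *)
Definition chain (i : nat) : zmodType := {ffun face i -> S}.

(* Position of v in s, for the ordering of V given by its enumeration. *)
Definition face_pos (s : {set V}) (v : V) : nat :=
  #|[set w in s | (enum_rank w < enum_rank v)%N]|.

(* Coefficient of e_t in the differential of e_s; the truncated subtraction
   of exponents is exact since lcm_face t divides lcm_face s for t \subset s. *)
Definition bd_coef (s t : {set V}) : S :=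
  \sum_(v in s | s :\ v == t)
    (-1) ^+ face_pos s v * 'X_[(lcm_face s - lcm_face t)%MM].

Definition bd (i : nat) (c : chain i.+1) : chain i :=
  [ffun t : face i => \sum_(s : face i.+1) c s * bd_coef (val s) (val t)].

(* The augmentation F_0 -> S/J is induced by e_set0 |-> 1; set0 is the only
   index of this sum. *)
Definition aug (c : chain 0) : S := \sum_(s : face 0) c s.

(* Exactness of ... -> F_2 -> F_1 -> F_0 -> S/J -> 0; elements of S/J are
   represented in S, equality being congruence modulo J. *)
Definition resolves_quotient (J : S -> Prop) : Prop :=
  [/\ forall p : S, exists c : chain 0, J (p - aug c),
      forall c : chain 0, J (aug c) <-> exists b, c = bd b
    & forall i (c : chain i.+1), bd c = 0 <-> exists b, c = bd b].

(* d(F_{i+1}) is contained in (x_1, ..., x_k) F_i. *)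
Definition minimal_differential : Prop :=
  forall i (c : chain i.+1) (t : face i), irrelevant_ideal (bd c t).

Definition supports_resolution (J : S -> Prop) : Prop :=
  generates (fun u => exists v, u = lab v) J /\ resolves_quotient J.

Definition supports_minimal_resolution (J : S -> Prop) : Prop :=
  supports_resolution J /\ minimal_differential.

End LabeledComplex.

Definition relabel (k : nat) (V : finType) (lab : V -> 'X_{1..k})
    (n m : 'X_{1..k}) : V -> 'X_{1..k} :=
  fun v => if lab v == n then m else lab v.

(* Main.v *)
(* Since m lies in C_I(n) and divides n, a monomial divisible by gcd(I) is
   divisible by m if and only if it is divisible by n.  Hence replacing the label
   n by m changes the lcm of a face only if that face is the vertex v labeled n.
   Multiplying e_v by n/m (and fixing the other basis elements) is then an
   injective chain map F_Delta -> F_Gamma, which is the identity in homological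
   degrees other than 1.  Its image contains the cycles of degree 1: in a syzygy
   on the new generators, m times the coefficient of e_v is a combination of the
   other generators, so it is divisible by gcd(I), hence by n.  So exactness
   transfers in both directions, with no appeal to the acyclicity criterion for
   the subcomplexes Delta_{<= u}. *)
Require Import Defs.
From HB Require Import structures.
From mathcomp Require Import all_boot all_order all_algebra.
From mathcomp.multinomials Require Import mpoly.

Set Implicit Arguments.
Unset Strict Implicit.
Unset Printing Implicit Defensive.

Import GRing.Theory.
Local Open Scope ring_scope.

(** * Divisibility order and lcms of exponent vectors *)

Lemma lepm_anti k (a b : 'X_{1..k}) : (a <= b)%MM -> (b <= a)%MM -> a = b.
Proof.
move=> /mnm_lepP le_ab /mnm_lepP le_ba; apply/mnmP => i.
by apply/anti_leq; rewrite le_ab le_ba.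
Qed.

Lemma lepm0 k (a : 'X_{1..k}) : (a <= 0)%MM -> a = 0%MM.
Proof. by move=> a0; apply: lepm_anti => //; apply/mnm_lepP => i; rewrite mnm0E. Qed.

Lemma subm_self k (a : 'X_{1..k}) : (a - a)%MM = 0%MM.
Proof. by apply/mnmP => i; rewrite mnmBE subnn mnm0E. Qed.

(** Lets lcm identities be proved by comparing multiples: with [lem_mlcm_seq], divisibility of [w]
    by an lcm splits into one test per entry. *)
Lemma lepm_eqP k (a b : 'X_{1..k}) :
  (forall w, (a <= w)%MM = (b <= w)%MM) -> a = b.
Proof.
move=> ab; have := ab a; have := ab b; rewrite !lepm_refl => ba /esym.
exact: lepm_anti.
Qed.

Lemma lem_mlcm_seq k (T : Type) (s : seq T) (F : T -> 'X_{1..k}) w :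
  (\big[@mlcm k/0%MM]_(a <- s) F a <= w)%MM = all (fun a => (F a <= w)%MM) s.
Proof.
elim: s => [|a s IHs] /=; last by rewrite big_cons lem_mlcm IHs.
by rewrite big_nil; apply/mnm_lepP => i; rewrite mnm0E.
Qed.

(** * Monomial ideals and their minimal generating sets *)

Section Ideals.
Variables (K : fieldType) (k : nat).
Local Notation S := {mpoly K[k]}.
Implicit Types (I J A : S -> Prop) (G : 'X_{1..k} -> Prop) (u v w n m : 'X_{1..k}).

Definition is_ideal J :=
  [/\ J 0, forall a b, J a -> J b -> J (a + b) & forall a b, J b -> J (a * b)].

Lemma ideal_sum J (T : eqType) (r : seq T) (P : pred T) (F : T -> S) :
  is_ideal J -> (forall x, x \in r -> P x -> J (F x)) ->
  J (\sum_(x <- r | P x) F x).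
Proof.
case=> J0 JD _ JF; rewrite big_seq_cond.
by apply: big_ind => // x /andP[]; apply: JF.
Qed.

Lemma ideal_gen_ideal A : is_ideal (ideal_gen A).
Proof.
split=> [|a b [s sA ->] [t tA ->]|a b [s sA ->]].
- by exists [::]; rewrite ?big_nil.
- exists (s ++ t); rewrite ?big_cat // => x.
  by rewrite mem_cat => /orP[/sA|/tA].
- exists [seq (a * x.1, x.2) | x <- s] => [x /mapP[y /sA ? ->] //|].
  by rewrite big_map mulr_sumr; apply: eq_bigr => x _; rewrite mulrA.
Qed.

Lemma mem_ideal_gen A p : A p -> ideal_gen A p.
Proof.
by exists [:: (1, p)]; rewrite ?big_seq1 ?mul1r // => x; rewrite inE => /eqP->.
Qed.

Lemma ideal_gen_min A J p :
  is_ideal J -> (forall q, A q -> J q) -> ideal_gen A p -> J p.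
Proof.
move=> idJ AJ [s sA ->]; apply: ideal_sum => // x xs _.
by case: idJ => _ _; apply; apply/AJ/sA.
Qed.

Lemma ideal_add_ideal I J : is_ideal I -> is_ideal J -> is_ideal (ideal_add I J).
Proof.
move=> [I0 ID IM] [J0 JD JM]; split.
- by exists 0, 0; rewrite addr0.
- move=> _ _ [a [b [Ia Jb ->]]] [c [d [Ic Jd ->]]].
  by exists (a + c), (b + d); rewrite addrACA; split; auto.
- move=> c _ [a [b [Ia Jb ->]]].
  by exists (c * a), (c * b); rewrite mulrDr; split; auto.
Qed.

Lemma generates_ideal G I : generates G I -> is_ideal I.
Proof.
move=> GI; case: (ideal_gen_ideal (monomial_gens (K := K) G)) => g0 gD gM.
split=> [|a b /GI Ia /GI Ib|a b /GI Ib]; apply/GI; auto.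
Qed.

Lemma msuppMX_le (p : S) u w : w \in msupp (p * 'X_[u]) -> (u <= w)%MM.
Proof.
move/msuppM_le/allpairsP=> [[a b] /= [_]].
by rewrite msuppX inE => /eqP-> ->; apply: lem_addl.
Qed.

(** Multiplying by ['X_[v]] yields only multiples of [v], and the support of a sum lies in the union
    of the supports. *)
Lemma msupp_ideal_gen G (p : S) w :
  ideal_gen (monomial_gens G) p -> w \in msupp p ->
  exists2 v, G v & (v <= w)%MM.
Proof.
case=> s sG ->; elim: s sG => [|x s IHs] sG.
  by rewrite big_nil msupp0.
rewrite big_cons => /msuppD_le; rewrite mem_cat => /orP[|ws].
  by have [v Gv ->] := sG x (mem_head _ _); move/msuppMX_le; exists v.
by apply: IHs ws => y ys; apply: sG; rewrite inE ys orbT.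
Qed.

Lemma generates_mono G I u :
  generates G I -> (I 'X_[u] <-> exists2 v, G v & (v <= u)%MM).
Proof.
move=> GI; split=> [/GI/msupp_ideal_gen|[v Gv vu]].
  by apply; rewrite msuppX inE.
apply/GI; rewrite -(submK vu) mpolyXD.
case: (ideal_gen_ideal (monomial_gens (K := K) G)) => _ _; apply.
by apply: mem_ideal_gen; exists v.
Qed.

Lemma generates_sub G G' I :
  generates G I -> (forall u, G' u -> G u) ->
  (forall u, G u -> exists2 v, G' v & (v <= u)%MM) -> generates G' I.
Proof.
move=> GI G'G GG' p; split=> [/GI|].
  apply: ideal_gen_min; first exact: ideal_gen_ideal.
  move=> _ [u /GG' [v G'v vu] ->].
  by apply/(@generates_mono G') => //; exists v.
apply: ideal_gen_min; first exact: generates_ideal GI.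
by move=> _ [u /G'G Gu ->]; apply/GI/mem_ideal_gen; exists u.
Qed.

Definition antichain G := forall u v, G u -> G v -> (u <= v)%MM -> u = v.

(** A generator divisible by another one is redundant. Conversely, a generating subset contains a
    divisor of each [u] in [G], and the antichain condition identifies that divisor with [u]. *)
Lemma minimal_generating_setP I G :
  minimal_generating_set I G <-> generates G I /\ antichain G.
Proof.
split=> [[GI Gmin]|[GI Ganti]]; split=> //.
- move=> u v Gu Gv uv; apply/eqP/negPn/negP => /eqP u_v.
  suff [] : G v /\ v <> v by [].
  (* Deleting [v] from [G] still generates [I], because [u] takes its place; minimality would then
     put [v] in the set without [v]. *)
  apply: (Gmin (fun w => G w /\ w <> v)) => // [w [] //|].
  apply: (generates_sub GI) => [w [] //|w Gw].
  have [->|/eqP wv] := eqVneq w v; first by exists u.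
  by exists w => //; apply: lepm_refl.
- move=> G' G'G G'I u Gu.
  have /(generates_mono _ GI)/(generates_mono _ G'I) [v G'v vu] :
    exists2 v, G v & (v <= u)%MM by exists u => //; apply: lepm_refl.
  by rewrite -(Ganti _ _ (G'G _ G'v) Gu vu).
Qed.

(** Uniqueness of the minimal generators: [u] in [H] is a multiple of some [v] in [G], itself a
    multiple of some [w] in [H]; the antichain [H] gives [w = u], so [v = u]. *)
Lemma MinGensP I G :
  generates G I -> antichain G -> forall u, MinGens I u <-> G u.
Proof.
move=> GI Ganti u; split=> [[H /minimal_generating_setP [HI Hanti] Hu]|Gu].
  have [|v Gv vu] := (generates_mono u GI).1.
    by apply/(generates_mono _ HI); exists u => //; apply: lepm_refl.
  have [|w Hw wv] := (generates_mono v HI).1.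
    by apply/(generates_mono _ GI); exists v => //; apply: lepm_refl.
  have wu := Hanti _ _ Hw Hu (lepm_trans wv vu).
  by rewrite (_ : u = v) //; apply: lepm_anti vu; rewrite -wu.
by exists G => //; apply/minimal_generating_setP.
Qed.

Lemma MinGens_generates I n :
  MinGens I n -> generates (MinGens I) I /\ antichain (MinGens I).
Proof.
move=> [G /minimal_generating_setP [GI Ganti] _].
have GP := MinGensP GI Ganti; split=> [|u v /GP Gu /GP Gv]; last exact: Ganti.
apply: (generates_sub GI) => u /GP // Gu.
by exists u; [|apply: lepm_refl].
Qed.

Lemma is_gcd_le I u p w : is_gcd I u -> I p -> w \in msupp p -> (u <= w)%MM.
Proof. by move=> [uI _] /uI [q ->]; apply: msuppMX_le. Qed.

Lemma add_monomial_gens I n m :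
  generates (MinGens I) I -> (m <= n)%MM ->
  generates (fun u => (MinGens I u /\ u <> n) \/ u = m) (add_monomial I m).
Proof.
move=> GI mn p; set G' := fun u => _.
have [gI0 gID gIM] := ideal_gen_ideal (monomial_gens (K := K) G').
have G'm : ideal_gen (monomial_gens (K := K) G') 'X_[m].
  by apply: mem_ideal_gen; exists m => //; right.
split=> [[a [b [/GI Ia Jb ->]]]|].
  apply: gID; last by apply: ideal_gen_min Jb => [|q -> //]; apply: ideal_gen_ideal.
  apply: ideal_gen_min Ia => [|_ [u Gu ->]]; first exact: ideal_gen_ideal.
  have [->|/eqP un] := eqVneq u n; first by rewrite -(submK mn) mpolyXD; apply: gIM.
  by apply: mem_ideal_gen; exists u => //; left.
have idI := generates_ideal GI; have [I0 _ _] := idI.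
have idm := ideal_gen_ideal (fun q : S => q = 'X_[m]); have [m0 _ _] := idm.
apply: ideal_gen_min => [|_ [u [[Gu _]|->] ->]]; first exact: ideal_add_ideal.
  by exists 'X_[u], 0; rewrite addr0; split=> //; apply/GI/mem_ideal_gen; exists u.
by exists 0, 'X_[m]; rewrite add0r; split=> //; apply: mem_ideal_gen.
Qed.

Lemma irrelevant_mono a : a <> 0%MM -> irrelevant_ideal ('X_[a] : S).
Proof.
move=> a0; have [i ai] : exists i, a i != 0%N.
  apply/existsP; rewrite -negb_forall; apply/negP => /forallP az.
  by apply: a0; apply/mnmP => i; rewrite mnm0E; apply/eqP.
have leia : (U_(i) <= a)%MM by rewrite lep1mP.
rewrite -(submK leia) mpolyXD.
case: (ideal_gen_ideal (fun p : S => exists i, p = 'X_i)) => _ _; apply.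
by apply: mem_ideal_gen; exists i.
Qed.

Lemma mpoly_divX (p : S) a :
  (forall w, w \in msupp p -> (a <= w)%MM) -> exists q, p = q * 'X_[a].
Proof.
move=> pa; exists (\sum_(w <- msupp p) p@_w *: 'X_[w - a]).
rewrite [LHS]mpolyE mulr_suml !big_seq; apply: eq_bigr => w wp.
by rewrite -scalerAl -mpolyXD submK ?pa.
Qed.

Lemma mulXI a : injective (fun p : S => p * 'X_[a]).
Proof.
by move=> p q /= pq; apply/mpolyP => w; rewrite -(mcoeffMX p a) pq mcoeffMX.
Qed.
End Ideals.

(** * Exchanging [n] for [m] in the minimal generators and in the lcm lattice *)

Section Exchange.
Variables (K : fieldType) (k : nat) (I : {mpoly K[k]} -> Prop).
Variables (g n m : 'X_{1..k}).
Hypotheses (hn : MinGens I n) (hg : is_gcd I g) (hm : Cset_mon g n m).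
Hypothesis hmn : (m <= n)%MM.

(** Coordinatewise: where [n i = g i] the bound comes from [g], and elsewhere the definition of
    [Cset_mon] gives [n i <= m i]. *)
Lemma Cset_exchange w : (g <= w)%MM -> (m <= w)%MM -> (n <= w)%MM.
Proof.
move=> /mnm_lepP gw /mnm_lepP mw; apply/mnm_lepP => i.
have [_ hm1 _] := hm; have [->//|/eqP/hm1 nm] := eqVneq (n i) (g i).
exact: leq_trans nm (mw i).
Qed.

Lemma exchange_le w : (g <= w)%MM -> (m <= w)%MM = (n <= w)%MM.
Proof.
by move=> gw; apply/idP/idP => [|nw]; [exact: Cset_exchange|exact: lepm_trans nw].
Qed.

Lemma MinGens_gcd_le a : MinGens I a -> (g <= a)%MM.
Proof.
move=> Ga; have [GI _] := MinGens_generates Ga.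
apply: (is_gcd_le hg (p := 'X_[a])); last by rewrite msuppX inE.
by apply/GI/mem_ideal_gen; exists a.
Qed.

Lemma Cset_proper : ~ (n <= m)%MM.
Proof.
have [_ _ [i _ lt_mn]] := hm => /mnm_lepP/(_ i).
by rewrite leqNgt lt_mn.
Qed.

Lemma MinGens_anti : antichain (MinGens I).
Proof. by move=> a b Ga; have [_] := MinGens_generates Ga; apply. Qed.

Lemma MinGens_le_new a : MinGens I a -> ~ (a <= m)%MM.
Proof.
move=> Ga am; have an := MinGens_anti Ga hn (lepm_trans am hmn).
by apply: Cset_proper; rewrite -an.
Qed.

Lemma new_le_MinGens a : MinGens I a -> (m <= a)%MM -> a = n.
Proof.
by move=> Ga ma; rewrite (MinGens_anti hn Ga) // Cset_exchange ?MinGens_gcd_le.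
Qed.

(** It remains to see that the new generators form an antichain: a minimal generator dividing [m]
    would divide [n], hence equal it, and one divisible by [m] is divisible by [n]. *)
Lemma MinGens_add u :
  MinGens (add_monomial I m) u <-> (MinGens I u /\ u <> n) \/ u = m.
Proof.
have [GI _] := MinGens_generates hn.
apply: (MinGensP (add_monomial_gens GI hmn)) => a b.
move=> [[Ga an]|->] [[Gb bn]|->] // ab; first exact: MinGens_anti.
  by case: (MinGens_le_new Ga ab).
by case: bn; apply: new_le_MinGens.
Qed.

Lemma new_neq0 : m <> 0%MM. Proof. by case: hm. Qed.

Lemma old_neq0 : n <> 0%MM.
Proof. by move=> n0; apply: new_neq0; apply: lepm0; rewrite -n0. Qed.

(** The monomial 1 is listed apart because it is the lcm of the empty set, which [g] need not
    divide. *)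
Lemma lcm_lattice_gcd_le u : lcm_lattice I u -> u = 0%MM \/ (g <= u)%MM.
Proof.
case=> -[|a s] sG ->; first by left; rewrite big_nil.
right; rewrite big_cons; apply: lepm_trans (lem_mlcml _ _).
by apply/MinGens_gcd_le/sG; rewrite mem_head.
Qed.

Lemma lcm_lattice_new u : lcm_lattice I u -> u <> m.
Proof.
move=> /lcm_lattice_gcd_le [-> /esym/new_neq0 //|gu um].
by apply: Cset_proper; apply: Cset_exchange; rewrite -?um // lepm_refl.
Qed.

Lemma lcm_lattice_new_le u : lcm_lattice I u -> (m <= u)%MM = (n <= u)%MM.
Proof.
case/lcm_lattice_gcd_le => [->|]; last exact: exchange_le.
by apply/idP/idP => /lepm0; [move/new_neq0|move/old_neq0].
Qed.

(** The entry [a] survives the substitution and forces every multiple of either lcm to be a multiple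
    of [g], where [x] and [y] cannot be told apart. Stated for general [x] and [y] so as to serve
    both directions of the exchange. *)
Lemma lcm_exchange x y a (s : seq 'X_{1..k}) :
  (forall w, (g <= w)%MM -> (x <= w)%MM = (y <= w)%MM) ->
  a \in s -> a <> x -> (g <= a)%MM ->
  \big[@mlcm k/0%MM]_(b <- [seq if b == x then y else b | b <- s]) b =
  \big[@mlcm k/0%MM]_(b <- s) b.
Proof.
move=> xy sa ax ga; apply: lepm_eqP => w; rewrite !lem_mlcm_seq all_map.
have [aw|naw] := boolP (a <= w)%MM.
  by apply: eq_all => b /=; case: eqP => // ->; rewrite xy // (lepm_trans ga aw).
rewrite (_ : all _ _ = false); first symmetry.
  by apply/negbTE/allPn; exists a.
by apply/negbTE/allPn; exists a => //=; case: eqP.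
Qed.

Lemma lcm_lattice_exchange u :
  (lcm_lattice I u /\ u <> n) <-> (lcm_lattice (add_monomial I m) u /\ u <> m).
Proof.
split=> [[Lu un]|[[s sG ->] um]].
  split; last exact: lcm_lattice_new.
  case: Lu un => s sG -> un.
  pose s' := [seq if b == n then m else b | b <- s].
  have s'G b : b \in s' -> MinGens (add_monomial I m) b.
    case/mapP=> c sc ->; apply/MinGens_add.
    by case: eqP => [_|cn]; [right|left; split=> //; apply: sG].
  (* With an entry other than [n], the substitution preserves the lcm. Otherwise [s] is empty or
     repeats [n], so that its lcm is 1 or the excluded [n]. *)
  have [/hasP[a sa /eqP an]|/hasPn sn] := boolP (has (predC1 n) s).
    exists s' => //; rewrite (@lcm_exchange n m a) //; last exact/MinGens_gcd_le/sG.
    by move=> w /exchange_le.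
  case: s => [|a s] in sG un sn s' s'G *; first by exists [::].
  case: un; apply: lepm_anti.
    by rewrite lem_mlcm_seq; apply/allP => b /sn; rewrite negbK => /eqP->; exact: lepm_refl.
  by have := sn a (mem_head _ _); rewrite negbK big_cons => /eqP->; apply: lem_mlcml.
pose s' := [seq if b == m then n else b | b <- s].
have s'G b : b \in s' -> MinGens I b.
  by case/mapP=> c sc ->; case: eqP => // cm; have /MinGens_add[[]|] := sG c sc.
have [/hasP[a sa /eqP am]|/hasPn sm] := boolP (has (predC1 m) s).
  have /MinGens_add[[Ga an]|//] := sG a sa.
  rewrite -(@lcm_exchange m n a) //; [|exact: exchange_le|exact: MinGens_gcd_le].
  split; first by exists s'.
  (* The substitution fixes [a], so if the lcm were [n], then [a] would be a minimal generator
     dividing [n]. *)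
  move=> sn; apply: an; apply: MinGens_anti => //.
  have : all (fun b => (b <= n)%MM) s' by rewrite -lem_mlcm_seq sn lepm_refl.
  by move/allP; apply; apply/mapP; exists a => //; case: eqP.
case: s => [|a s] in sG um sm s' s'G *.
  by rewrite big_nil; split; [exists [::]; rewrite ?big_nil|move/esym/old_neq0].
case: um; apply: lepm_anti.
  by rewrite lem_mlcm_seq; apply/allP => b /sm; rewrite negbK => /eqP->; exact: lepm_refl.
by have := sm a (mem_head _ _); rewrite negbK big_cons => /eqP->; apply: lem_mlcml.
Qed.
End Exchange.

(** * Face labels, the differential, and comparison of two labelings *)

Section LabeledComplexes.
Variables (K : fieldType) (k : nat) (V : finType).
Implicit Types (lab : V -> 'X_{1..k}).
Local Notation S := {mpoly K[k]}.

Lemma lem_lcm_face lab (s : {set V}) w :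
  (lcm_face lab s <= w)%MM = [forall v in s, (lab v <= w)%MM].
Proof.
rewrite /lcm_face -big_filter lem_mlcm_seq.
apply/allP/forall_inP => sw v; last by rewrite mem_filter => /andP[/sw].
by move=> vs; apply: sw; rewrite mem_filter vs mem_index_enum.
Qed.

Lemma le_lcm_face lab (s : {set V}) v : v \in s -> (lab v <= lcm_face lab s)%MM.
Proof.
have := lepm_refl (lcm_face lab s); rewrite lem_lcm_face => /forall_inP; exact.
Qed.

Lemma lcm_faceS lab (s t : {set V}) :
  t \subset s -> (lcm_face lab t <= lcm_face lab s)%MM.
Proof.
move=> /subsetP ts; rewrite lem_lcm_face; apply/forall_inP => v /ts.
exact: le_lcm_face.
Qed.

Lemma lcm_face0 lab : lcm_face lab set0 = 0%MM.
Proof. by rewrite /lcm_face big_set0. Qed.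

Lemma lcm_face1 lab v : lcm_face lab [set v] = lab v.
Proof.
apply: lepm_eqP => w; rewrite lem_lcm_face.
apply/forall_inP/idP => [|vw u]; first by apply; rewrite inE.
by rewrite inE => /eqP->.
Qed.

Lemma bd_coef_eq lab lab' (s t : {set V}) :
  lcm_face lab s = lcm_face lab' s -> lcm_face lab t = lcm_face lab' t ->
  bd_coef K lab s t = bd_coef K lab' s t.
Proof. by rewrite /bd_coef => -> ->. Qed.

Lemma bd_coef1 lab v : bd_coef K lab [set v] set0 = 'X_[lab v].
Proof.
rewrite /bd_coef (big_pred1 v) => [|w]; last first.
  by rewrite inE /=; have [->|//] := eqVneq w v; rewrite setDv eqxx.
rewrite lcm_face0 lcm_face1 subm0 /face_pos (_ : [set _ in _ | _] = set0).
  by rewrite cards0 expr0 mul1r.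
by apply/setP => w; rewrite !inE; have [->|//] := eqVneq w v; rewrite ltnn.
Qed.

Lemma bd_coef_irrelevant lab (s t : {set V}) :
  (forall v, v \in s -> t = s :\ v -> lcm_face lab s <> lcm_face lab t) ->
  irrelevant_ideal (bd_coef K lab s t).
Proof.
move=> ne; have idJ := ideal_gen_ideal (fun p : S => exists i, p = 'X_i).
apply: ideal_sum => // v _ /andP[vs /eqP st].
case: (idJ) => _ _; apply; apply: irrelevant_mono => st0.
apply: (ne v) => //; have ts : t \subset s by rewrite -st subsetDl.
by rewrite -(submK (lcm_faceS lab ts)) st0 add0m.
Qed.

Section Complex.
Variable D : {set {set V}}.
Local Notation chain := (chain K k D).

Lemma card_face i (s : face D i) : #|val s| = i.
Proof. by apply/eqP; have /andP[] := valP s. Qed.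

Definition single i (s0 : face D i) (p : S) : chain i :=
  [ffun s => if s == s0 then p else 0].

Lemma bd_single lab i (s0 : face D i.+1) p (t : face D i) :
  bd lab (single (i := i.+1) s0 p) t = p * bd_coef K lab (val s0) (val t).
Proof.
rewrite ffunE (bigD1 s0) //= ffunE eqxx big1 ?addr0 // => s /negbTE s_s0.
by rewrite ffunE s_s0 mul0r.
Qed.

(** Evaluating on basis elements reduces minimality to the matrix entries. *)
Lemma minimal_differentialP lab :
  minimal_differential K lab D <->
  forall i (s : face D i.+1) (t : face D i),
    irrelevant_ideal (bd_coef K lab (val s) (val t)).
Proof.
have idJ := ideal_gen_ideal (fun p : S => exists i, p = 'X_i).
split=> [dmin i s t|cmin i c t].
  by have := dmin i (single s 1) t; rewrite bd_single mul1r.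
rewrite ffunE; apply: ideal_sum => // s _ _.
by case: idJ => _ _; apply; apply: cmin.
Qed.

(** The comparison map from the complex of [lab] to that of [lab'], sending e_s to the quotient of
    its two labels times e_s. The truncated subtraction is a true quotient when the [lab'] label
    divides the [lab] label, as [bd_rescale] assumes. *)
Definition rescale lab lab' i (c : chain i) : chain i :=
  [ffun s => c s * 'X_[lcm_face lab (val s) - lcm_face lab' (val s)]].

Lemma bdD lab i (b c : chain i.+1) : bd lab (b + c) = bd lab b + bd lab c.
Proof.
apply/ffunP => t; rewrite !ffunE -big_split.
by apply: eq_bigr => s _; rewrite ffunE mulrDl.
Qed.

Lemma rescale0 lab lab' i : rescale lab lab' (0 : chain i) = 0.
Proof. by apply/ffunP => s; rewrite !ffunE mul0r. Qed.

Lemma rescale_inj lab lab' i : injective (@rescale lab lab' i).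
Proof.
move=> b c bc; apply/ffunP => s.
by move/ffunP/(_ s): bc; rewrite !ffunE => /mulXI.
Qed.

Lemma bd_rescale lab lab' i (c : chain i.+1) :
  (forall s, (lcm_face lab' s <= lcm_face lab s)%MM) ->
  bd lab' (rescale lab lab' c) = rescale lab lab' (bd lab c).
Proof.
move=> le_lab; apply/ffunP => t; rewrite !ffunE mulr_suml.
apply: eq_bigr => s _; rewrite ffunE -!mulrA; congr (_ * _).
rewrite /bd_coef mulr_sumr mulr_suml; apply: eq_bigr => v /andP[vs /eqP st].
rewrite mulrCA -!mulrA -!mpolyXD; congr (_ * 'X_[_]).
have /mnm_lepP ts : (lcm_face lab (val t) <= lcm_face lab (val s))%MM.
  by rewrite lcm_faceS // -st subsetDl.
have /mnm_lepP ts' : (lcm_face lab' (val t) <= lcm_face lab' (val s))%MM.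
  by rewrite lcm_faceS // -st subsetDl.
have /mnm_lepP les := le_lab (val s); have /mnm_lepP le_t := le_lab (val t).
(* Both exponents telescope to the [lab] label of [s] minus the [lab'] label of [t]. *)
apply/mnmP => j; rewrite !mnmDE !mnmBE.
rewrite addnBA // subnK // addnBA // subnK //.
Qed.

(** A diagram chase: cycles for [lab'] pull back along the injective chain map [rescale], and
    boundaries of chains of degree at least 2 agree up to [rescale], which is the identity there. *)
Lemma rescale_exact lab lab' :
  (forall s, (lcm_face lab' s <= lcm_face lab s)%MM) ->
  (forall s : {set V}, (1 < #|s|)%N -> lcm_face lab' s = lcm_face lab s) ->
  (forall c' : chain 1, bd lab' c' = 0 -> exists c, c' = rescale lab lab' c) ->
  (forall i (c : chain i.+1), bd lab c = 0 <-> exists b, c = bd lab b) <->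
  (forall i (c : chain i.+1), bd lab' c = 0 <-> exists b, c = bd lab' b).
Proof.
move=> le_lab eq_lab ker1; have comm i c := @bd_rescale lab lab' i c le_lab.
have rescale_id i (c : chain i.+2) : rescale lab lab' c = c.
  apply/ffunP => s; rewrite ffunE eq_lab ?subm_self ?mpolyX0 ?mulr1 //.
  by rewrite card_face.
have ker_im i (c' : chain i.+1) :
    bd lab' c' = 0 -> exists c, c' = rescale lab lab' c.
  case: i c' => [|i] c' dc'; [exact: ker1 | exists c'; exact/esym/rescale_id].
split=> ex i c; split.
- move=> dc'; have [c0 cE] := ker_im _ _ dc'.
  have /ex [b bE] : bd lab c0 = 0.
    by apply: (@rescale_inj lab lab'); rewrite -comm -cE dc' rescale0.
  by exists (rescale lab lab' b); rewrite comm -bE.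
- case=> b ->; rewrite -(rescale_id _ b) !comm (_ : bd lab _ = 0) ?rescale0 //.
  by apply/ex; exists b.
- move=> dc; have /ex [b bE] : bd lab' (rescale lab lab' c) = 0.
    by rewrite comm dc rescale0.
  by exists b; apply: (@rescale_inj lab lab'); rewrite bE -comm rescale_id.
- case=> b ->; apply: (@rescale_inj lab lab'); rewrite -!comm rescale0.
  by apply/ex; exists (rescale lab lab' b).
Qed.

Hypothesis hD : simplicial_complex D.

Lemma face0P : (set0 \in D) && (#|@set0 V| == 0%N).
Proof. by case: hD => -> _ _; rewrite cards0. Qed.
Definition face0 : face D 0 := Sub set0 face0P.

Lemma face0_eq (s : face D 0) : s = face0.
Proof. by apply: val_inj; apply/cards0_eq/card_face. Qed.

Lemma face1P v : ([set v] \in D) && (#|[set v]| == 1%N).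
Proof. by case: hD => _ -> _; rewrite cards1. Qed.
Definition face1 v : face D 1 := Sub [set v] (face1P v).

Lemma face1_eq (s : face D 1) : exists v, s = face1 v.
Proof.
have /eqP/cards1P [v sv] := card_face s.
by exists v; apply: val_inj.
Qed.

Lemma augE (c : chain 0) : aug c = c face0.
Proof. by rewrite /aug (big_pred1 face0) // => s; rewrite [s]face0_eq /= eqxx. Qed.

Lemma bd1E lab (c : chain 1) :
  bd lab c face0 = \sum_(s : face D 1) c s * 'X_[lcm_face lab (val s)].
Proof.
rewrite ffunE; apply: eq_bigr => s _.
by have [v ->] := face1_eq s; rewrite bd_coef1 lcm_face1.
Qed.

(** In degree 0 the complex is S itself, and the first differential has as image the ideal generated
    by the labels; only exactness in positive degrees is a condition on [D]. *)
Lemma resolves_quotient_generated lab (J : S -> Prop) :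
  generates (fun u => exists v, u = lab v) J ->
  resolves_quotient lab D J <->
  (forall i (c : chain i.+1), bd lab c = 0 <-> exists b, c = bd lab b).
Proof.
move=> GJ; have idJ := generates_ideal GJ; have [J0 JD JM] := idJ.
split=> [[]//|ex]; split=> // [p|c].
  by exists [ffun _ => p]; rewrite augE ffunE subrr.
split=> [/GJ Jc|[b ->]]; last first.
  rewrite augE bd1E; apply: ideal_sum => // s _ _; apply: JM.
  have [v ->] := face1_eq s; rewrite lcm_face1.
  by apply/GJ/mem_ideal_gen; exists (lab v) => //; exists v.
(* The image of the first differential, read as a subset of S; it is an ideal containing every
   label, hence all of [J]. *)
pose im p := exists b : chain 1, p = bd lab b face0.
suff [b bE] : im (aug c).
  by exists b; apply/ffunP => s; rewrite [s]face0_eq -bE augE.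
apply: (@ideal_gen_min _ _ _ im) Jc => [|_ [_ [v ->] ->]]; last first.
  by exists (single (face1 v) 1); rewrite bd_single mul1r bd_coef1.
split=> [|_ _ [b ->] [c' ->]|p _ [b ->]].
- by exists 0; rewrite bd1E big1 // => s _; rewrite ffunE mul0r.
- by exists (b + c'); rewrite bdD !ffunE.
- exists [ffun s => p * b s]; rewrite !bd1E mulr_sumr.
  by apply: eq_bigr => s _; rewrite ffunE mulrA.
Qed.

End Complex.
End LabeledComplexes.

(** * Passing from the labels of Delta to those of Gamma *)

Section Relabeling.
Variables (K : fieldType) (k : nat) (I : {mpoly K[k]} -> Prop).
Variables (g n m : 'X_{1..k}).
Hypotheses (hn : MinGens I n) (hg : is_gcd I g) (hm : Cset_mon g n m).
Hypothesis hmn : (m <= n)%MM.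
Variables (V : finType) (lab : V -> 'X_{1..k}).
Hypotheses (lab_inj : injective lab)
  (labP : forall u, MinGens I u <-> exists v, u = lab v).
Variables (D : {set {set V}}) (hD : simplicial_complex D).
Variables (v0 : V) (lab_v0 : lab v0 = n).
Let lab' := relabel lab n m.

Lemma relabelE v : lab' v = if v == v0 then m else lab v.
Proof. by rewrite /lab' /relabel -lab_v0 (inj_eq lab_inj). Qed.

Lemma gcd_le_lab v : (g <= lab v)%MM.
Proof. by apply: (MinGens_gcd_le hg); apply/labP; exists v. Qed.

Lemma relabel_le v : (lab' v <= lab v)%MM.
Proof. by rewrite relabelE; case: eqP => [->|_]; rewrite ?lab_v0 ?lepm_refl. Qed.

Lemma lcm_relabel_le (s : {set V}) : (lcm_face lab' s <= lcm_face lab s)%MM.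
Proof.
rewrite lem_lcm_face; apply/forall_inP => v vs.
exact: lepm_trans (relabel_le v) (le_lcm_face _ vs).
Qed.

(** If [v0] lies in [s], another vertex [w] does too; its unchanged label is a multiple of [g], so
    the new lcm is a multiple of [g] and [m], hence of [n]. *)
Lemma lcm_relabel (s : {set V}) :
  s <> [set v0] -> lcm_face lab' s = lcm_face lab s.
Proof.
move=> s_v0; apply: lepm_anti; first exact: lcm_relabel_le.
rewrite lem_lcm_face; apply/forall_inP => v vs.
have := le_lcm_face lab' vs; rewrite relabelE; case: eqP => // v_v0 ms.
rewrite v_v0 lab_v0; apply: (Cset_exchange hm) => //.
have [w ws w_v0] : exists2 w, w \in s & w != v0.
  have [/exists_inP//|/exists_inPn sv0] := boolP [exists w in s, w != v0].
  case: s_v0; apply/setP => w; rewrite inE; apply/idP/eqP => [|->].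
    by move/sv0/negPn/eqP.
  by rewrite -v_v0.
have := le_lcm_face lab' ws; rewrite relabelE (negbTE w_v0).
exact: lepm_trans (gcd_le_lab w).
Qed.

Lemma labels_generate : generates (fun u => exists v, u = lab v) I.
Proof.
have [GI _] := MinGens_generates hn.
by apply: (generates_sub GI) => u /labP // Gu; exists u; rewrite ?lepm_refl.
Qed.

Lemma new_labels_generate :
  generates (fun u => exists v, u = lab' v) (add_monomial I m).
Proof.
have [GI _] := MinGens_generates hn.
have E u : ((MinGens I u /\ u <> n) \/ u = m) <-> exists v, u = lab' v.
  split=> [[[/labP [v ->] ne]|->]|[v ->]].
  - by exists v; rewrite relabelE; case: eqP => // v_v0; case: ne; rewrite v_v0.
  - by exists v0; rewrite relabelE eqxx.
  - rewrite relabelE; case: eqP => ne; [by right|left].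
    by split; [apply/labP; exists v|rewrite -lab_v0 => /lab_inj].
apply: (generates_sub (add_monomial_gens GI hmn)) => u /E // Gu.
by exists u; rewrite ?lepm_refl.
Qed.

Lemma relabel_subcx u : lcm_lattice I u -> u <> n ->
  subcx_le lab D u = subcx_le lab' D u /\ subcx_lt lab D u = subcx_lt lab' D u.
Proof.
move=> Lu un; have um := lcm_lattice_new hg hm Lu.
have le_n := lcm_lattice_new_le hg hm hmn Lu.
(* Only the face [[set v0]] changes label, from [n] to [m]; these divide [u] simultaneously, and [u]
   equals neither. *)
split; apply/setP => s; rewrite !inE; congr (_ && _);
  have [->|/eqP s_v0] := eqVneq s [set v0].
- by rewrite !lcm_face1 relabelE eqxx lab_v0.
- by rewrite lcm_relabel.
- rewrite !lcm_face1 relabelE eqxx lab_v0 le_n; congr (_ && _).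
  by rewrite (introN eqP (nesym un)) (introN eqP (nesym um)).
- by rewrite lcm_relabel.
Qed.

Lemma relabel_syzygy (c' : chain K k D 1) :
  bd lab' c' = 0 -> exists c, c' = rescale lab lab' c.
Proof.
move=> dc'.
have main (s : face D 1) w : w \in msupp (c' s) ->
    (lcm_face lab (val s) - lcm_face lab' (val s) <= w)%MM.
  have [s_v0 cw|/eqP s_v0 _] := eqVneq (val s) [set v0]; last first.
    by rewrite lcm_relabel // subm_self; apply/mnm_lepP => i; rewrite mnm0E.
  rewrite s_v0 !lcm_face1 relabelE eqxx lab_v0.
  (* Divisibility of the monomial [w] by n/m is restated as [n] dividing [w + m], a monomial of [c'
     s * 'X_[m]]. *)
  suff /mnm_lepP nw : (n <= w + m)%MM.
    by apply/mnm_lepP => i; rewrite mnmBE leq_subLR addnC -mnmDE.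
  apply: (Cset_exchange hm); last exact: lem_addl.
  suff [u gu uw] : exists2 u, (g <= u)%MM & (u <= w + m)%MM by apply: lepm_trans uw.
  have : bd lab' c' (face0 hD) = 0 by rewrite dc' ffunE.
  rewrite bd1E (bigD1 s) //= s_v0 lcm_face1 relabelE eqxx => /eqP.
  (* The syzygy expresses [c' s * 'X_[m]] through the labels of the other vertices, all multiples of
     [g]. *)
  rewrite addr_eq0 => /eqP c's.
  have idG := ideal_gen_ideal (monomial_gens (K := K) (fun u => (g <= u)%MM)).
  apply: (@msupp_ideal_gen K k _ (c' s * 'X_[m])); last first.
    by rewrite mcoeff_msupp addmC mcoeffMX -mcoeff_msupp.
  rewrite c's -mulN1r; case: (idG) => _ _; apply; apply: ideal_sum => // t _ t_s.
  case: (idG) => _ _; apply; apply: mem_ideal_gen.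
  have [v tv] := face1_eq hD t; exists (lab v); first exact: gcd_le_lab.
  rewrite tv lcm_face1 relabelE; case: eqP => // v_v0; case/eqP: t_s.
  by apply: val_inj; rewrite s_v0 tv v_v0.
have /fin_all_exists [q qE] s :
    exists q, c' s = q * 'X_[lcm_face lab (val s) - lcm_face lab' (val s)].
  exact/mpoly_divX/main.
by exists [ffun s => q s]; apply/ffunP => s; rewrite !ffunE.
Qed.

Lemma relabel_resolution :
  supports_resolution lab D I <-> supports_resolution lab' D (add_monomial I m).
Proof.
have G := labels_generate; have G' := new_labels_generate.
have R := resolves_quotient_generated hD G.
have R' := resolves_quotient_generated hD G'.
have big (s : {set V}) : (1 < #|s|)%N -> lcm_face lab' s = lcm_face lab s.
  by move=> s1; apply: lcm_relabel => sv; rewrite sv cards1 in s1.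
have E := rescale_exact lcm_relabel_le big relabel_syzygy.
split=> [[_ /R/E/R']|[_ /R'/E/R]] //; by split.
Qed.

(** Entries of the differential can change only in the column or the row of [[set v0]]; there both
    versions are shown to lie in the irrelevant ideal. *)
Lemma relabel_minimal :
  minimal_differential K lab D <-> minimal_differential K lab' D.
Proof.
have same i (s : face D i.+1) (t : face D i) :
    bd_coef K lab (val s) (val t) = bd_coef K lab' (val s) (val t) \/
    irrelevant_ideal (bd_coef K lab (val s) (val t)) /\
    irrelevant_ideal (bd_coef K lab' (val s) (val t)).
  have [s_v0|/eqP s_v0] := eqVneq (val s) [set v0].
    right; split; apply: bd_coef_irrelevant => v;
      rewrite s_v0 inE => /eqP -> ->; rewrite setDv lcm_face0 lcm_face1.
      by rewrite lab_v0; apply: old_neq0 hm hmn.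
    by rewrite relabelE eqxx; apply: new_neq0 hm.
  have [t_v0|/eqP t_v0] := eqVneq (val t) [set v0]; last first.
    by left; apply: bd_coef_eq; rewrite lcm_relabel.
  (* If [s] had lcm [n], the label of the removed vertex [v] would be a minimal generator dividing
     [n], so [v = v0]; but [v0] remains in [t]. *)
  have ne v : v \in val s -> val t = val s :\ v -> lcm_face lab (val s) <> n.
    move=> vs tE sn; have vn : (lab v <= n)%MM by rewrite -sn le_lcm_face.
    have v_v0 : v = v0.
      apply: lab_inj; apply: (@MinGens_anti K k I) => //; rewrite ?lab_v0 //.
      by apply/labP; exists v.
    have : v0 \in val t by rewrite t_v0 inE.
    by rewrite tE v_v0 !inE eqxx.
  right; split; apply: bd_coef_irrelevant => v vs tE.
    by rewrite t_v0 lcm_face1 lab_v0; apply: ne vs tE.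
  rewrite t_v0 lcm_face1 relabelE eqxx lcm_relabel // => sm.
  (* After relabeling, [s] keeps its old lcm, a multiple of [n], so it cannot have lcm [m]. *)
  apply: (Cset_proper hm); rewrite -sm -lab_v0 le_lcm_face //.
  have /subsetP : val t \subset val s by rewrite tE subsetDl.
  by apply; rewrite t_v0 inE.
split=> /minimal_differentialP dmin; apply/minimal_differentialP => i s t;
  by have := dmin i s t; case: (same i s t) => [->|[]].
Qed.

End Relabeling.

Theorem theorem4p10 (K : fieldType) (k : nat) (I : {mpoly K[k]} -> Prop)
    (hI : monomial_ideal I) (n m : 'X_{1..k})
    (hn : MinGens I n) (hm : Cset I n m) (hmn : (m <= n)%MM)
    (V : finType) (lab : V -> 'X_{1..k}) (lab_inj : injective lab)
    (labP : forall u, MinGens I u <-> exists v, u = lab v)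
    (D : {set {set V}}) (hD : simplicial_complex D) :
  let lab' := relabel lab n m in
  let I' := add_monomial I m in
  [/\ forall u, (lcm_lattice I u /\ u <> n) <-> (lcm_lattice I' u /\ u <> m),
      forall u, lcm_lattice I u -> u <> n ->
        subcx_le lab D u = subcx_le lab' D u /\
        subcx_lt lab D u = subcx_lt lab' D u,
      supports_resolution lab D I <-> supports_resolution lab' D I'
    & supports_minimal_resolution lab D I <->
        supports_minimal_resolution lab' D I'].
Proof.
move=> lab' I'; have [g hg hmg] := hm.
have [v0 /esym lab_v0] := (labP n).1 hn.
have res := relabel_resolution hn hg hmg hmn lab_inj labP hD lab_v0.
have dmin := relabel_minimal hn hg hmg hmn lab_inj labP D lab_v0.
split=> //.
- exact: lcm_lattice_exchange hn hg hmg hmn.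
- by move=> u Lu un;
    exact (relabel_subcx hg hmg hmn lab_inj labP D lab_v0 Lu un).
- by split=> [[/res ? /dmin ?]|[/res ? /dmin ?]].
Qed.
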